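(* Let $k,\ell$ be coprime integers with $k>\ell\geqslant 1$, let $A(z),B(z)\in\mathbb{C}[z]$ be non-zero polynomials with $\deg(A(z)B(z))\geqslant 1$, and let $\{P_n(z)\}_{n\geqslant 0}$ be the polynomial sequence defined by $$P_n(z)+B(z)P_{n-\ell}(z)+A(z)P_{n-k}(z)=0\quad (n\geqslant 1),\qquad P_0(z)=1,\quad P_{-1}(z)=\cdots=P_{1-k}(z)=0.$$ Let $z_0\in\mathcal{Z}_{\{P_n(z)\}}-\mathcal{Z}_{A(z)}$, i.e. $z_0$ is a zero of some polynomial $P_n(z)$ that is not identically zero, and $A(z_0)\neq 0$. Let $D(t;z_0)=A(z_0)t^k+B(z_0)t^{\ell}+1$, a polynomial in $t$. Then at least one of the following holds (zeros being counted with multiplicity): (a) $D(t;z_0)$ has at least two equimodular zeros; (b) $D(t;z_0)$ has exactly three null-collinear zeros if $k$ is odd, or two null-collinear zeros if $k$ is even.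
   Context: For a non-zero polynomial $f$, $\mathcal{Z}_{f(z)}$ is the set of complex zeros of $f$; for a non-empty set $\mathcal{X}$ of non-zero complex polynomials, $\mathcal{Z}_{\mathcal{X}}=\bigcup_{f\in\mathcal{X}}\mathcal{Z}_{f(z)}$. $\mathcal{Z}_{\{P_n(z)\}}$ is the union of the zero sets of those $P_n(z)$ that are not identically zero. Equimodular means having the same absolute value. Null-collinear means that the points (two of them for $k$ even, three of them for $k$ odd) lie on a line in the complex plane through the origin $O$, with at least one of the points on either side of $O$. *)

(* Defs.v *)
From HB Require Import structures.
From mathcomp Require Import all_boot all_order all_algebra.
From mathcomp Require Import boolp classical_sets reals.
From mathcomp Require Import complex.

Set Implicit Arguments.
Unset Strict Implicit.
Unset Printing Implicit Defensive.

Import Order.TTheory GRing.Theory Num.Theory.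

Local Open Scope ring_scope.
Local Open Scope classical_set_scope.
Local Open Scope complex_scope.

Definition zeros (R : realType) (f : {poly R[i]}) : set R[i] :=
  [set z | root f z].

Definition zeros_of_set (R : realType) (X : set {poly R[i]}) : set R[i] :=
  \bigcup_(f in X) zeros f.

Definition nonzero_terms (R : realType) (P : int -> {poly R[i]}) :
    set {poly R[i]} :=
  [set f | f != 0 /\ exists2 n : int, 0 <= n & f = P n].

(* The values of P below index 1 - k are unconstrained: they never occur in
   the recurrence. *)
Definition three_term_sequence (R : realType) (k l : nat) (A B : {poly R[i]})
    (P : int -> {poly R[i]}) : Prop :=
  [/\ forall n : int, 1 <= n -> P n + B * P (n - l%:Z) + A * P (n - k%:Z) = 0,
      P 0 = 1
    & forall n : int, 1 - k%:Z <= n <= -1 -> P n = 0].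

Definition Dpoly (R : realType) (k l : nat) (A B : {poly R[i]}) (z0 : R[i]) :
    {poly R[i]} :=
  A.[z0] *: 'X^k + B.[z0] *: 'X^l + 1.

(* s enumerates all the zeros of the (nonzero) polynomial p, each repeated
   according to its multiplicity. *)
Definition lists_zeros (R : realType) (p : {poly R[i]}) (s : seq R[i]) : Prop :=
  forall x : R[i], count_mem x s = mup x p.

Definition equimodular (R : realType) (x y : R[i]) : bool := `|x| == `|y|.

Definition has_two_equimodular_zeros (R : realType) (p : {poly R[i]}) : Prop :=
  exists2 s : seq R[i], lists_zeros p s &
    exists i j : nat, (i < j < size s)%N /\ equimodular s`_i s`_j.

(* For u != 0, the line through the origin and u. *)
Definition on_line (R : realType) (u z : R[i]) : bool := z / u \is Num.real.

(* The order of R[i] is partial: 0 < w (resp. w < 0) says that w is a positive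
   (resp. negative) real, so the last two clauses put a point of s on each of
   the two open rays from the origin that make up the line. *)
Definition null_collinear_along (R : realType) (u : R[i]) (s : seq R[i]) :
    bool :=
  [&& u != 0, all (on_line u) s,
      has (fun z => 0 < z / u) s & has (fun z => z / u < 0) s].

(* Some line through the origin carries exactly m zeros of p, counted with
   multiplicity, and these are null-collinear. *)
Definition has_exactly_null_collinear_zeros (R : realType) (m : nat)
    (p : {poly R[i]}) : Prop :=
  exists2 s : seq R[i], lists_zeros p s &
    exists u : R[i], let s_u := [seq z <- s | on_line u z] in
      size s_u = m /\ null_collinear_along u s_u.

(* Main.v *)
Require Import Defs.
From HB Require Import structures.
From mathcomp Require Import all_boot all_order all_algebra.
From mathcomp Require Import boolp classical_sets reals.
From mathcomp Require Import complex.
From mathcomp Require Import topology normedtype sequences exp trigo.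
From mathcomp Require Import ring lra zify.

(* Put q_n = P_n(z0), a = A(z0), b = B(z0). If b = 0, all zeros of D are
   equimodular. Otherwise, if y = (-a)^l / (-b)^k is not a negative real, then
   up to conjugation and a rescaling q_n c^-n the recurrence becomes q_n =
   q_{n-l} + x q_{n-k} with x of argument theta, 0 <= l theta < pi. On the
   semigroup generated by k and l one can then choose arguments phi_n of the
   q_n with phi_n <= phi_{n+l} and phi_{n+k} <= phi_n + theta: going from n -
   l to n - k in k-1 steps of -l and l-1 steps of +k shows that the arguments
   of the two summands of q_n differ by at most l theta < pi, so q_n lies in
   the cone they span and does not vanish. Hence a zero q_n = 0 forces y to be
   real, and the substitution s = c t turns D into a trinomial with real
   coefficients. A non-real zero and its conjugate are equimodular; if all
   zeros are real, l > 2 or k - l > 2 would make the sum of the squares of the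
   inverses of the zeros, or of the zeros, vanish; so k <= 3, and for k = 3
   the sum of the zeros or of their inverses is 0, so both signs occur. For k
   = 2 the zero q_n = 0 gives t_1^(n+1) = t_2^(n+1) directly. *)

Set Implicit Arguments.
Unset Strict Implicit.
Unset Printing Implicit Defensive.

Import Order.TTheory GRing.Theory Num.Theory.
Import numFieldNormedType.Exports.

Local Open Scope ring_scope.
Local Open Scope classical_set_scope.
Local Open Scope complex_scope.

Definition cis (R : realType) (t : R) : R[i] := cos t +i* sin t.

Definition has_phase (R : realType) (z : R[i]) (t : R) : Prop :=
  exists2 r : R, 0 < r & z = r%:C * cis t.

Lemma cis0 (R : realType) : cis (0 : R) = 1.
Proof. by rewrite /cis cos0 sin0. Qed.

Lemma cisD (R : realType) (s t : R) : cis (s + t) = cis s * cis t.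
Proof.
apply/eqP; rewrite eq_complex /= sinD cosD eqxx /=.
by apply/eqP; ring.
Qed.

Lemma cisMn (R : realType) (t : R) (n : nat) : cis (t *+ n) = cis t ^+ n.
Proof. by elim: n => [|n IHn]; rewrite ?cis0 // mulrS cisD IHn exprS. Qed.

Lemma cis_neq0 (R : realType) (t : R) : cis t != 0.
Proof.
apply/eqP => /(congr1 (fun z => z * cis (- t))).
by rewrite mul0r -cisD subrr cis0 => /eqP; rewrite oner_eq0.
Qed.

Lemma has_phase_neq0 (R : realType) (z : R[i]) (t : R) : has_phase z t -> z != 0.
Proof.
move=> [r r0 ->]; rewrite mulf_neq0 ?cis_neq0 //.
by rewrite (inj_eq (@complexI R) r 0) gt_eqF.
Qed.

Lemma has_phaseM (R : realType) (y z : R[i]) (s t : R) :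
  has_phase y s -> has_phase z t -> has_phase (y * z) (s + t).
Proof.
move=> [r r0 ->] [q q0 ->]; exists (r * q); first exact: mulr_gt0.
by rewrite cisD rmorphM /= mulrACA.
Qed.

Lemma has_phaseD (R : realType) (y z : R[i]) (s t : R) :
    has_phase y s -> has_phase z t -> s <= t -> t < s + pi ->
  exists2 g : R, s <= g <= t & has_phase (y + z) g.
Proof.
move=> [r r0 ->] [q q0 ->] lest ltt.
have [eqst|nest] := eqVneq s t.
  exists s; first by rewrite lexx.
  by exists (r + q); rewrite ?addr_gt0 // eqst rmorphD mulrDl.
have ltst : s < t by rewrite lt_neqAle nest.
(* The ray of argument g carries the sum iff the components orthogonal to it
   cancel, i.e. iff f g = 0. *)
pose f (g : R) := r * sin (g - s) - q * sin (t - g).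
have cf : {within `[s, t], continuous f}.
  apply: continuous_subspaceT => g.
  apply: cvgB; apply: cvgM; try exact: cvg_cst.
    apply: (@continuous_comp _ _ _ (fun g => g - s) sin).
      by apply: cvgB; [exact: cvg_id | exact: cvg_cst].
    exact: continuous_sin.
  apply: (@continuous_comp _ _ _ (fun g => t - g) sin).
    by apply: cvgB; [exact: cvg_cst | exact: cvg_id].
  exact: continuous_sin.
have sst : 0 < sin (t - s) by apply: sin_gt0_pi; lra.
have [g + fg0] : exists2 g, g \in `[s, t]%R & f g = 0.
  apply: (@IVT R f s t 0 lest cf); rewrite /f !subrr sin0 !mulr0 subr0 sub0r.
  have := mulr_gt0 r0 sst; have := mulr_gt0 q0 sst => h1 h2.
  by rewrite ge_min le_max; apply/andP; split; apply/orP; [left|right]; lra.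
rewrite in_itv /= => gst; exists g => //.
pose m := r * cos (g - s) + q * cos (t - g).
have ss : 0 <= sin (g - s) by apply: sin_ge0_pi; lra.
have E2 : q * sin (t - g) = r * sin (g - s) by move: fg0; rewrite /f => fg0; lra.
have E : q * sin (t - s) = sin (g - s) * m.
  have -> : t - s = (g - s) + (t - g) by ring.
  transitivity (sin (g - s) * (q * cos (t - g)) + cos (g - s) * (q * sin (t - g))).
    by rewrite sinD; ring.
  by rewrite E2 /m; ring.
have m0 : 0 < m.
  have : 0 < sin (g - s) * m by rewrite -E mulr_gt0.
  by rewrite pmulr_rgt0 // lt_neqAle ss andbT; apply/eqP => H;
     have := mulr_gt0 q0 sst; rewrite E -H mul0r ltxx.
exists m => //.
have -> : cis s = cis (s - g) * cis g by rewrite -cisD subrK.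
have -> : cis t = cis (t - g) * cis g by rewrite -cisD subrK.
rewrite !mulrA -mulrDl; congr (_ * _).
rewrite /cis -(opprB g s) cosN sinN; apply/eqP; rewrite eq_complex /= /m.
rewrite !mul0r !subr0 !addr0 eqxx /=.
by apply/eqP; lra.
Qed.

Definition representable (k l n : nat) : Prop :=
  exists i j : nat, n = (l * i + k * j)%N.

Definition trinomial_rec (K : nzRingType) (k l : nat) (b a : K) (q : nat -> K) :
    Prop :=
  q 0 = 1 /\ forall n : nat, (0 < n)%N ->
    q n = b * (if (l <= n)%N then q (n - l)%N else 0) +
          a * (if (k <= n)%N then q (n - k)%N else 0).

Lemma representable0 (k l : nat) : representable k l 0.
Proof. by exists 0, 0; rewrite !muln0. Qed.

Lemma representableDl (k l n : nat) : representable k l n -> representable k l (n + l).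
Proof. by move=> [i [j ->]]; exists i.+1, j; lia. Qed.

Lemma representableDk (k l n : nat) : representable k l n -> representable k l (n + k).
Proof. by move=> [i [j ->]]; exists i, j.+1; lia. Qed.

Lemma representable_pred (k l n : nat) : representable k l n -> (0 < n)%N ->
  ((l <= n)%N /\ representable k l (n - l)) \/ ((k <= n)%N /\ representable k l (n - k)).
Proof.
move=> [[|i] [j ->]] n0.
  right; case: j n0 => [|j] n0; first by rewrite !muln0 in n0.
  by split; [|exists 0, j]; lia.
by left; split; [|exists i, j]; lia.
Qed.

Lemma trinomial_rec_nonrep (K : nzRingType) (k l : nat) (b a : K)
    (q : nat -> K) (n : nat) :
  (0 < l)%N -> (0 < k)%N ->
  trinomial_rec k l b a q -> ~ representable k l n -> q n = 0.
Proof.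
move=> l0 k0 [q0 qr]; elim/ltn_ind: n => n IHn nrep.
have [n0|n0] := posnP n; first by case: nrep; rewrite n0; exact: representable0.
have H d : (0 < d)%N -> (forall m, representable k l m -> representable k l (m + d)) ->
    (if (d <= n)%N then q (n - d)%N else 0) = 0.
  move=> d0 repD; case: ifP => // dn; apply: IHn; first by lia.
  by move/repD; rewrite subnK.
rewrite qr // !H ?mulr0 ?addr0 //; first exact: representableDk.
exact: representableDl.
Qed.

(* phi n is an argument of q n, lifted to a real number as these grow unboundedly. *)
Definition phases (R : realType) (k l : nat) (theta : R) (q : nat -> R[i])
    (N : nat) (phi : nat -> R) : Prop :=
  [/\ forall n, (n < N)%N -> representable k l n ->
        has_phase (q n) (phi n) /\ 0 <= phi n,
      forall n, (n + l < N)%N -> representable k l n -> phi n <= phi (n + l)%N,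
      forall n, (n + k < N)%N -> representable k l n ->
        phi (n + k)%N <= phi n + theta
    & forall i, (i < k)%N -> (l * i < N)%N -> phi (l * i)%N = 0].

Lemma phases_iter_l (R : realType) (k l : nat) (theta : R) q N phi (n i : nat) :
  phases k l theta q N phi -> representable k l n -> (n + l * i < N)%N ->
  phi n <= phi (n + l * i)%N.
Proof.
move=> [_ H _ _] rn; elim: i => [|i IHi] ltN; first by rewrite muln0 addn0.
apply: (le_trans (IHi _)); first by lia.
rewrite mulnSr addnA; apply: H; first by lia.
by case: rn => i' [j' ->]; exists (i' + i)%N, j'; lia.
Qed.

Lemma phases_iter_k (R : realType) (k l : nat) (theta : R) q N phi (n j : nat) :
  phases k l theta q N phi -> representable k l n -> (n + k * j < N)%N ->
  phi (n + k * j)%N <= phi n + theta *+ j.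
Proof.
move=> [_ _ H _] rn; elim: j => [|j IHj] ltN; first by rewrite muln0 !addn0 addr0.
rewrite mulnSr addnA mulrSr addrA; apply: (le_trans (H _ _ _)); first by lia.
  by case: rn => i' [j' ->]; exists i', (j' + j)%N; lia.
by rewrite lerD2r IHj //; lia.
Qed.

Lemma phases_ext (R : realType) (k l : nat) (theta : R) q N phi g :
    (0 < l)%N -> (0 < k)%N -> phases k l theta q N phi ->
    (representable k l N -> has_phase (q N) g /\ 0 <= g) ->
    ((l <= N)%N -> representable k l (N - l) -> phi (N - l)%N <= g) ->
    ((k <= N)%N -> representable k l (N - k) -> g <= phi (N - k)%N + theta) ->
    (forall i, (i < k)%N -> N = (l * i)%N -> g = 0) ->
  phases k l theta q N.+1 (fun n => if n == N then g else phi n).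
Proof.
move=> l0 k0 [H1 H2 H3 H4] g1 g2 g3 g4; split => [n|n|n|i].
- rewrite ltnS leq_eqVlt => /orP[/eqP ->|ltn]; first by rewrite eqxx.
  by rewrite (ltn_eqF ltn); exact: H1.
- move=> + rn; rewrite ltnS leq_eqVlt => /orP[/eqP E|ltn].
    rewrite E eqxx ltn_eqF; last by lia.
    have -> : n = (N - l)%N by lia.
    by apply: g2; [lia|rewrite -E addnK //].
  by rewrite (ltn_eqF ltn) ltn_eqF; [exact: H2|lia].
- move=> + rn; rewrite ltnS leq_eqVlt => /orP[/eqP E|ltn].
    rewrite E eqxx ltn_eqF; last by lia.
    have -> : n = (N - k)%N by lia.
    by apply: g3; [lia|rewrite -E addnK //].
  by rewrite (ltn_eqF ltn) ltn_eqF; [exact: H3|lia].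
- move=> ik; rewrite ltnS leq_eqVlt => /orP[/eqP E|ltn].
    by rewrite E eqxx; apply: (g4 i).
  by rewrite (ltn_eqF ltn); exact: H4.
Qed.

Lemma nonrep_mul (k l i : nat) : coprime k l -> (i < k)%N -> (k <= l * i)%N ->
  ~ representable k l (l * i - k).
Proof.
move=> ckl ik kli [i' [j E]].
have E2 : (l * (i - i') = k * j.+1)%N by nia.
have : (k %| i - i')%N by rewrite -(Gauss_dvdr _ ckl) E2 dvdn_mulr.
have : (0 < i - i')%N by nia.
by move=> h /(dvdn_leq h); lia.
Qed.

Lemma phases_compare_lower (R : realType) (k l : nat) (theta : R) q N phi :
    (0 < l)%N -> (0 < k)%N -> 0 <= theta -> phases k l theta q N phi ->
    (l <= N)%N -> representable k l (N - l) ->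
    (k <= N)%N -> representable k l (N - k) ->
  phi (N - l)%N <= phi (N - k)%N + theta.
Proof.
move=> l0 k0 th0 ph lN rl kN rk; have [H1 H2 H3 H4] := ph.
have [rlk|nlk] := pselect ((l + k <= N)%N /\ representable k l (N - l - k)).
  have [lkN rlk'] := rlk.
  apply: (@le_trans _ _ (phi (N - l - k)%N + theta)).
    have {1}-> : (N - l = N - l - k + k)%N by lia.
    by apply: H3 => //; lia.
  rewrite lerD2r; have -> : (N - k = N - l - k + l)%N by lia.
  by apply: H2 => //; lia.
case: (rl) => i [[|j] E]; last first.
  by case: nlk; split; [nia|exists i, j; nia].
have ik : (i < k)%N.
  rewrite ltnNge; apply/negP => ki; case: nlk; split; first by nia.
  by exists (i - k)%N, l.-1; nia.
have -> : phi (N - l)%N = 0 by rewrite E muln0 addn0 H4 //; lia.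
by rewrite addr_ge0 //; apply: (H1 _ _ rk).2; lia.
Qed.

Lemma phases_compare_upper (R : realType) (k l : nat) (theta : R) q N phi :
    (0 < l)%N -> (0 < k)%N -> 0 <= theta -> phases k l theta q N phi ->
    (l <= N)%N -> representable k l (N - l) ->
    (k <= N)%N -> representable k l (N - k) ->
  phi (N - k)%N <= phi (N - l)%N + theta *+ l.-1.
Proof.
move=> l0 k0 th0 ph lN rl kN rk; have [H1 H2 H3 H4] := ph.
have main i j : (N - k = l * i + k * j)%N -> (l.-1 <= j)%N ->
    phi (N - k)%N <= phi (N - l)%N + theta *+ l.-1.
  move=> E lj; pose m := (l * i + k * (j - l.-1))%N.
  have rm : representable k l m by exists i, (j - l.-1)%N.
  have E1 : (N - k = m + k * l.-1)%N by rewrite /m; nia.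
  have E2 : (N - l = m + l * k.-1)%N.
    move: E1; rewrite -(prednK l0) -(prednK k0) /=; lia.
  rewrite E1; apply: (le_trans (phases_iter_k ph rm _)); first by lia.
  by rewrite lerD2r E2; apply: (phases_iter_l ph rm); lia.
(* If N - k = l i + k j with j < l - 1, the path of k-1 steps of -l and l-1 steps
   of +k may leave the semigroup, unless i >= k, when k copies of l are traded for
   l copies of k. *)
have [i [j E]] := rk.
have [lj|jl] := leqP l.-1 j; first exact: main E lj.
have [ki|ik] := leqP k i; first by apply: (main (i - k)%N (j + l)%N); nia.
rewrite E; have rli : representable k l (l * i) by exists i, 0; lia.
apply: (le_trans (phases_iter_k ph rli _)); first by lia.
rewrite H4 //; last by lia.
rewrite lerD ?(H1 _ _ rl).2 //; first by lia.
by apply: ler_wpMn2l => //; lia.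
Qed.

Lemma phases_exist (R : realType) (k l : nat) (theta : R) (x : R[i])
    (q : nat -> R[i]) :
    coprime k l -> (0 < l)%N -> (0 < k)%N ->
    0 <= theta -> theta *+ l < pi -> has_phase x theta ->
    trinomial_rec k l 1 x q ->
  forall N, exists phi, phases k l theta q N phi.
Proof.
move=> ckl l0 k0 th0 thpi hx hq; have [q0 qr] := hq.
elim=> [|N [phi ph]]; first by exists (fun=> 0); split.
have [H1 H2 H3 H4] := ph.
suff [g [g1 g2 g3 g4]] : exists g, [/\
    (representable k l N -> has_phase (q N) g /\ 0 <= g),
    ((l <= N)%N -> representable k l (N - l) -> phi (N - l)%N <= g),
    ((k <= N)%N -> representable k l (N - k) -> g <= phi (N - k)%N + theta) &
    (forall i, (i < k)%N -> N = (l * i)%N -> g = 0)].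
  by exists (fun n => if n == N then g else phi n); exact: phases_ext.
have [N0|N0] := posnP N.
  exists 0; rewrite N0; split; rewrite ?leqn0 ?(gtn_eqF l0) ?(gtn_eqF k0) //.
  by move=> _; split=> //; exists 1; rewrite // q0 cis0 mulr1.
have qE : q N = (if (l <= N)%N then q (N - l)%N else 0) +
                x * (if (k <= N)%N then q (N - k)%N else 0) by rewrite qr // mul1r.
have nrep d : ~ ((d <= N)%N /\ representable k l (N - d)) ->
    (if (d <= N)%N then q (N - d)%N else 0) = 0.
  move=> nd; case: ifP => // dN; apply: trinomial_rec_nonrep hq _ => // rd.
  exact: nd.
have [[lN rl]|nl] := pselect ((l <= N)%N /\ representable k l (N - l));
have [[kN rk]|nk] := pselect ((k <= N)%N /\ representable k l (N - k)).
- have [hl hl0] : has_phase (q (N - l)%N) (phi (N - l)%N) /\ 0 <= phi (N - l)%N.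
    by apply: H1 => //; lia.
  have [hk hk0] : has_phase (q (N - k)%N) (phi (N - k)%N) /\ 0 <= phi (N - k)%N.
    by apply: H1 => //; lia.
  have le1 := phases_compare_lower l0 k0 th0 ph lN rl kN rk.
  have le2 := phases_compare_upper l0 k0 th0 ph lN rl kN rk.
  have [g /andP[g1 g2] hg] : exists2 g, phi (N - l)%N <= g <= phi (N - k)%N + theta &
      has_phase (q N) g.
    rewrite qE lN kN; apply: has_phaseD => //.
      by rewrite addrC; exact: has_phaseM.
    apply: (@le_lt_trans _ _ (phi (N - l)%N + theta *+ l)); last by rewrite ltrD2l.
    by rewrite -(prednK l0) mulrSr addrA lerD2r prednK.
  exists g; split=> //; first by split=> //; exact: le_trans g1.
  by move=> i ik E; case: (@nonrep_mul k l i); rewrite -?E.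
- exists (phi (N - l)%N); have hl := H1 (N - l)%N.
  rewrite qE lN (nrep k) // mulr0 addr0; split=> //.
  + by move=> _; apply: hl => //; lia.
  + by move=> kN rk; case: nk.
  + move=> i ik E; have -> : (N - l = l * i.-1)%N by nia.
    by apply: H4; nia.
- exists (phi (N - k)%N + theta); have hk := H1 (N - k)%N.
  rewrite qE kN (nrep l) // add0r; split=> //.
  + move=> _; have [||h1 h2] := hk => //; first by lia.
    by split; [rewrite addrC; exact: has_phaseM|exact: addr_ge0].
  + by move=> lN rl; case: nl.
  + by move=> i ik E; case: (@nonrep_mul k l i); rewrite -?E.
- exists 0; split.
  + by move=> /representable_pred-/(_ N0)[].
  + by move=> lN rl; case: nl.
  + by move=> kN rk; case: nk.
  + by [].
Qed.

Lemma trinomial_rec_neq0 (R : realType) (k l : nat) (theta : R) (x : R[i])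
    (q : nat -> R[i]) (n : nat) :
    coprime k l -> (0 < l)%N -> (0 < k)%N ->
    0 <= theta -> theta *+ l < pi -> has_phase x theta ->
    trinomial_rec k l 1 x q -> representable k l n -> q n != 0.
Proof.
move=> ckl l0 k0 th0 thpi hx hq rn.
have [phi [H _ _ _]] := phases_exist ckl l0 k0 th0 thpi hx hq n.+1.
by have [/has_phase_neq0] := H n (ltnSn n) rn.
Qed.

Lemma coprime_common_base (F : fieldType) (k l : nat) (a b : F) :
    coprime k l -> (0 < l)%N -> a != 0 -> b != 0 -> a ^+ l = b ^+ k ->
  exists c : F, [/\ c != 0, c ^+ l = b & c ^+ k = a].
Proof.
move=> ckl l0 a0 b0 ab.
have [u v uv _] := egcdnP k l0.
have {}uv : (u * l = v * k + 1)%N by rewrite uv gcdnC (eqP ckl).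
exists (b ^+ u / a ^+ v); split.
- by rewrite mulf_neq0 ?invr_eq0 ?expf_neq0.
- rewrite expr_div_n -!exprM uv addn1 exprS [(v * k)%N]mulnC exprM -ab -exprM.
  by rewrite [(l * v)%N]mulnC mulfK // expf_neq0.
- rewrite expr_div_n -!exprM [(u * k)%N]mulnC exprM -ab -exprM [(l * u)%N]mulnC uv.
  by rewrite addn1 exprS mulfK // expf_neq0.
Qed.

Lemma upper_half_has_phase (R : realType) (z : R[i]) :
  z != 0 -> ~~ (z < 0) -> 0 <= complex.Im z ->
  exists2 t : R, 0 <= t < pi & has_phase z t.
Proof.
case: z => a b; rewrite ltcE eq_complex /= [0 == b]eq_sym => z0 zneg b0.
pose r := Num.sqrt (a ^+ 2 + b ^+ 2).
have s0 : 0 < a ^+ 2 + b ^+ 2.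
  rewrite lt_neqAle addr_ge0 ?sqr_ge0 // andbT eq_sym paddr_eq0 ?sqr_ge0 //.
  by rewrite !sqrf_eq0.
have r0 : 0 < r by rewrite sqrtr_gt0.
have r2 : r ^+ 2 = a ^+ 2 + b ^+ 2 by rewrite sqr_sqrtr // ltW.
have ra : `|a| <= r by rewrite -sqrtr_sqr ler_wsqrtr // lerDl sqr_ge0.
have ar : - r < a.
  have [a0|a0] := leP 0 a; first by lra.
  have b1 : 0 < b ^+ 2.
    by rewrite lt_neqAle sqr_ge0 andbT eq_sym sqrf_eq0; move: zneg; rewrite a0 andbT.
  by nra.
have ar1 : -1 < a / r by rewrite ltr_pdivlMr // mulN1r.
have ar2 : a / r <= 1 by rewrite ler_pdivrMr // mul1r (le_trans (ler_norm a)).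
exists (acos (a / r)); first by rewrite acos_ge0 ?acos_ltpi ?ar1 ?ar2 ?(ltW ar1).
exists r => //; rewrite /cis sin_acos ?ar2 ?(ltW ar1) // acosK; last first.
  by rewrite in_itv /= ar2 (ltW ar1).
have -> : 1 - (a / r) ^+ 2 = (b / r) ^+ 2.
  rewrite !expr_div_n r2; have : a ^+ 2 + b ^+ 2 != 0 by rewrite gt_eqF.
  by move=> ?; field.
rewrite sqrtr_sqr ger0_norm ?divr_ge0 ?(ltW r0) //.
apply/eqP; rewrite eq_complex /= !mul0r subr0 addr0.
by rewrite ![r * _]mulrC !divfK ?eqxx ?gt_eqF.
Qed.

Lemma has_phase_root (R : realType) (l : nat) (y : R[i]) (t : R) : (0 < l)%N ->
  has_phase y t -> exists2 x, x ^+ l = y & has_phase x (t / l%:R).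
Proof.
move=> l0 [r r0 ->]; pose p := expR (ln r / l%:R).
have l00 : l%:R != 0 :> R by rewrite pnatr_eq0 -lt0n.
exists (p%:C * cis (t / l%:R)); last by exists p => //; exact: expR_gt0.
rewrite exprMn -cisMn -[t / _ *+ _]mulr_natr divfK // -rmorphXn /=; congr (_%:C * _).
by rewrite /p -expRM_natr divfK // lnK.
Qed.

Lemma trinomial_rec_rescale (F : fieldType) (k l : nat) (c b a x : F) (q : nat -> F) :
    c != 0 -> b = c ^+ l -> a = c ^+ k * x -> trinomial_rec k l b a q ->
  trinomial_rec k l 1 x (fun n => q n / c ^+ n).
Proof.
move=> c0 -> -> [q0 qr]; split=> [|n n0]; first by rewrite q0 expr0 divr1.
have H d : c ^+ d * (if (d <= n)%N then q (n - d)%N else 0) / c ^+ n =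
    if (d <= n)%N then q (n - d)%N / c ^+ (n - d) else 0.
  case: ifP => dn; last by rewrite mulr0 mul0r.
  rewrite -{2}(subnKC dn) exprD invfM mulrACA divff ?mul1r //.
  by rewrite expf_neq0.
rewrite qr // mul1r -!H.
by move: (if _ then _ else _) (if _ then _ else _) (c ^+ n)^-1 => y z w; ring.
Qed.

Lemma trinomial_rec_upper_neq0 (R : realType) (k l : nat) (b a : R[i])
    (q : nat -> R[i]) (n : nat) :
    coprime k l -> (0 < l)%N -> (0 < k)%N -> a != 0 -> b != 0 ->
    0 <= complex.Im (a ^+ l / b ^+ k) -> ~~ (a ^+ l / b ^+ k < 0) ->
    trinomial_rec k l b a q -> representable k l n -> q n != 0.
Proof.
move=> ckl l0 k0 a0 b0 im nneg hq rn.
have y0 : a ^+ l / b ^+ k != 0 by rewrite mulf_neq0 ?invr_eq0 ?expf_neq0.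
have [t /andP[t0 tpi] ht] := upper_half_has_phase y0 nneg im.
have [x xl hx] := has_phase_root l0 ht.
have x0 := has_phase_neq0 hx.
have l00 : 0 < l%:R :> R by rewrite ltr0n.
have [c [c0 cl ck]] : exists c, [/\ c != 0, c ^+ l = b & c ^+ k = a / x].
  apply: coprime_common_base => //; first by rewrite mulf_neq0 ?invr_eq0.
  by rewrite expr_div_n xl invfM invrK mulrA divff ?mul1r // expf_neq0.
have hq' : trinomial_rec k l 1 x (fun m => q m / c ^+ m).
  by apply: trinomial_rec_rescale hq; rewrite // ck divfK.
have := trinomial_rec_neq0 ckl l0 k0 _ _ hx hq' rn.
rewrite divr_ge0 ?(ltW l00) // -[_ / _ *+ _]mulr_natr divfK ?(gt_eqF l00) //.
move=> /(_ isT tpi).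
by rewrite mulf_eq0 negb_or => /andP[].
Qed.

Lemma trinomial_rec_zero_lt0 (R : realType) (k l : nat) (b a : R[i])
    (q : nat -> R[i]) (n : nat) :
    coprime k l -> (0 < l)%N -> (0 < k)%N -> a != 0 -> b != 0 ->
    trinomial_rec k l b a q -> representable k l n -> q n = 0 ->
  a ^+ l / b ^+ k < 0.
Proof.
move=> ckl l0 k0 a0 b0 hq rn qn; apply/negP => /negP nneg.
have [im|im] := leP 0 (complex.Im (a ^+ l / b ^+ k)).
  by move: (trinomial_rec_upper_neq0 ckl l0 k0 a0 b0 im nneg hq rn); rewrite qn eqxx.
have yJ : a^*%C ^+ l / b^*%C ^+ k = (a ^+ l / b ^+ k)^*%C.
  by rewrite rmorphM /= conjc_inv !rmorphXn.
have [q0 qr] := hq.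
have hqJ : trinomial_rec k l b^*%C a^*%C (fun m => (q m)^*%C).
  split=> [|m m0]; first by rewrite q0 conjc1.
  by rewrite qr // rmorphD !rmorphM /=; do 2![case: ifP => _]; rewrite ?conjc0.
have := @trinomial_rec_upper_neq0 R k l b^*%C a^*%C _ n ckl l0 k0.
rewrite !conjc_eq0 yJ => /(_ _ a0 b0 _ _ hqJ rn); rewrite qn conjc0 eqxx.
case: (a ^+ l / b ^+ k) im nneg => yr yi /= im nneg; rewrite oppr_ge0 (ltW im).
by rewrite ltcE /= eq_sym oppr_eq0 (lt_eqF im) => /(_ isT isT).
Qed.

Definition trinomial (K : nzRingType) (k l : nat) (a b : K) : {poly K} :=
  a *: 'X^k + b *: 'X^l + 1.

Lemma coef_trinomial (K : nzRingType) (k l : nat) (a b : K) (i : nat) :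
  (trinomial k l a b)`_i =
  a * (i == k)%:R + b * (i == l)%:R + (i == 0)%:R.
Proof. by rewrite /trinomial !coefD !coefZ !coefXn coef1. Qed.

Lemma horner_trinomial (K : comNzRingType) (k l : nat) (a b x : K) :
  (trinomial k l a b).[x] = a * x ^+ k + b * x ^+ l + 1.
Proof. by rewrite /trinomial !hornerE. Qed.

Lemma size_trinomial (K : nzRingType) (k l : nat) (a b : K) :
  a != 0 -> (l < k)%N -> size (trinomial k l a b) = k.+1.
Proof.
move=> a0 lk; apply/eqP; rewrite eqn_leq; apply/andP; split.
  apply/leq_sizeP => i ki; rewrite coef_trinomial.
  by rewrite !gtn_eqF ?mulr0 ?addr0 //; lia.
rewrite ltnNge; apply/negP => /leq_sizeP/(_ k (leqnn k)) /eqP.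
by rewrite coef_trinomial eqxx !gtn_eqF ?mulr1 ?mulr0 ?addr0 ?(negbTE a0) //; lia.
Qed.

Lemma trinomial_factor (R : realType) (k l : nat) (a b : R[i]) :
    a != 0 -> (l < k)%N ->
  exists s : seq R[i], [/\ lists_zeros (trinomial k l a b) s, size s = k
    & trinomial k l a b = a *: \prod_(z <- s) ('X - z%:P)].
Proof.
move=> a0 lk; have [s] := closed_field_poly_normal (trinomial k l a b).
have -> : lead_coef (trinomial k l a b) = a.
  rewrite lead_coefE size_trinomial // coef_trinomial eqxx !gtn_eqF; try lia.
  by rewrite mulr1 mulr0 !addr0.
move=> E; exists s; split=> //.
  move=> x; rewrite E -mul_polyC mupMr ?mu_prod_XsubC //.
  by rewrite rootC.
apply: succn_inj; rewrite -(size_trinomial b a0 lk) E size_scale //.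
by rewrite size_prod_XsubC.
Qed.

Lemma equimodular_of_distinct (R : realType) (p : {poly R[i]}) (s : seq R[i])
    (x y : R[i]) :
    lists_zeros p s -> x \in s -> y \in s -> x != y -> `|x| = `|y| ->
  has_two_equimodular_zeros p.
Proof.
move=> hs xs ys xy nxy; exists s => //.
have : index x s != index y s.
  apply: contra xy => /eqP E.
  by rewrite -(nth_index 0 xs) E nth_index.
rewrite neq_ltn => /orP[h|h].
  exists (index x s), (index y s); rewrite h index_mem ys; split=> //.
  by rewrite !nth_index // /equimodular nxy.
exists (index y s), (index x s); rewrite h index_mem xs; split=> //.
by rewrite !nth_index // /equimodular nxy.
Qed.

Lemma coef_low_prod_XsubC (F : fieldType) (s : seq F) : 0 \notin s ->
  let p := \prod_(z <- s) ('X - z%:P) in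
  [/\ p`_0 != 0, p`_1 = - p`_0 * (\sum_(z <- s) z^-1)
    & p`_2 *+ 2 =
      p`_0 * ((\sum_(z <- s) z^-1) ^+ 2 - \sum_(z <- s) z^-1 ^+ 2)].
Proof.
elim: s => [_|z s IHs] /=.
  rewrite !big_nil !coef1 oner_eq0 mul0rn expr2 !mulr0 subr0 mulr0.
  by split.
rewrite inE negb_or eq_sym => /andP[z0 /IHs[]].
rewrite !big_cons; move: (\prod_(_ <- _) _) => p.
rewrite !mulrBl !coefB !coefXM !coefCM /= => p0 -> p2.
split; first by rewrite sub0r oppr_eq0 mulf_neq0.
  by field.
by rewrite mulrnBl -[(z * _) *+ 2]mulrnAr p2; field.
Qed.

Lemma coef_high_prod_XsubC (F : comNzRingType) (s : seq F) :
  let p := 'X^2 * \prod_(z <- s) ('X - z%:P) in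
  p`_(size s).+1 = - (\sum_(z <- s) z) /\
  p`_(size s) *+ 2 = (\sum_(z <- s) z) ^+ 2 - \sum_(z <- s) z ^+ 2.
Proof.
have coefS p z n : (('X - z%:P) * p : {poly F})`_n.+1 = p`_n - z * p`_n.+1.
  by rewrite mulrBl coefB coefXM coefCM.
suff : let p := 'X^2 * \prod_(z <- s) ('X - z%:P) in
  [/\ p`_(size s).+2 = 1, p`_(size s).+1 = - (\sum_(z <- s) z)
    & p`_(size s) *+ 2 = (\sum_(z <- s) z) ^+ 2 - \sum_(z <- s) z ^+ 2].
  by case.
elim: s => [|z s /= [IH0 IH1 IH2]] /=.
  by rewrite !big_nil mulr1 !coefXn /= mul0rn expr2 mul0r subr0 oppr0.
rewrite !big_cons mulrCA !coefS.
have IH3 : ('X^2 * \prod_(z <- s) ('X - z%:P))`_(size s).+3 = 0.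
  by rewrite coefXnM /= subn2 /= nth_default // size_prod_XsubC.
by rewrite IH0 IH1 IH3; split; [ring|ring|rewrite mulrnBl IH2; ring].
Qed.

Lemma real_sqr_sum_neq0 (F : numFieldType) (s : seq F) :
  all (fun z => z \is Num.real) s -> 0 \notin s -> s != [::] ->
  \sum_(z <- s) z ^+ 2 != 0.
Proof.
move=> sr s0 sn; apply/eqP => /eqP; rewrite big_seq psumr_eq0 => [|z zs].
  case: s sn s0 sr => // z s _; rewrite inE negb_or eq_sym => /andP[z0 _] _ /=.
  by rewrite mem_head /= sqrf_eq0 (negbTE z0).
by rewrite real_exprn_even_ge0 // (allP sr).
Qed.

Lemma real_sum0_has_gt0 (F : numFieldType) (s : seq F) :
  all (fun z => z \is Num.real) s -> 0 \notin s -> s != [::] ->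
  \sum_(z <- s) z = 0 -> has (fun z => 0 < z) s.
Proof.
move=> sr s0 sn sum0; apply/negPn; rewrite -all_predC; apply/negP => /allP sneg.
have : \sum_(z <- s) - z == 0 by rewrite sumrN sum0 oppr0.
rewrite big_seq psumr_eq0 => [|z zs].
  case: s sn s0 sr sneg {sum0} => // z s _.
  rewrite inE negb_or eq_sym => /andP[z0 _] _ _ /=.
  by rewrite mem_head /= oppr_eq0 (negbTE z0).
by rewrite oppr_ge0 real_leNgt ?real0 ?(allP sr) //; exact: sneg.
Qed.

Lemma real_sum0_has_lt0 (F : numFieldType) (s : seq F) :
  all (fun z => z \is Num.real) s -> 0 \notin s -> s != [::] ->
  \sum_(z <- s) z = 0 -> has (fun z => z < 0) s.
Proof.
move=> sr s0 sn sum0.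
have : has (fun z => 0 < z) [seq - z | z <- s].
  apply: real_sum0_has_gt0.
  - by rewrite all_map; apply: sub_all sr => z; rewrite /= realN.
  - by rewrite -oppr0 (mem_map oppr_inj).
  - by case: s sn {sr s0 sum0}.
  - by rewrite big_map sumrN sum0 oppr0.
by rewrite has_map; apply: sub_has => z /=; rewrite oppr_gt0.
Qed.

Lemma real_odd_root (R : realType) (n : nat) (x : R[i]) : odd n -> x \is Num.real ->
  exists2 y : R[i], y \is Num.real & y ^+ n = x.
Proof.
move=> on /complex_realP[r ->].
have n0 : n%:R != 0 :> R by rewrite pnatr_eq0; case: n on.
have pos (p : R) : 0 < p -> exists y, y ^+ n = p.
  by move=> p0; exists (expR (ln p / n%:R)); rewrite -expRM_natr divfK // lnK.
suff [y yr] : exists y, y ^+ n = r.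
  by exists y%:C; [apply/complex_realP; exists y|rewrite -rmorphXn /= yr].
have [r0|r0|->] := ltgtP r 0; last by exists 0; rewrite expr0n; case: n on {n0 pos}.
  have [y yr] := pos (- r) ltac:(by rewrite oppr_gt0).
  by exists (- y); rewrite exprNn yr -signr_odd on expr1 mulN1r opprK.
exact: pos.
Qed.

Lemma real_rescale (R : realType) (k l : nat) (b a : R[i]) :
    coprime k l -> (0 < l)%N -> a != 0 -> b != 0 -> a ^+ l / b ^+ k \is Num.real ->
  exists u v c : R[i], [/\ u \is Num.real, v \is Num.real, c != 0,
    b = u * c ^+ l & a = v * c ^+ k].
Proof.
move=> ckl l0 a0 b0 yr; set y := a ^+ l / b ^+ k in yr.
have y0 : y != 0 by rewrite mulf_neq0 ?invr_eq0 ?expf_neq0.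
have bk : b ^+ k != 0 by rewrite expf_neq0.
have [u [v [ur vr u0 v0 E]]] : exists u v : R[i], [/\ u \is Num.real, v \is Num.real,
    u != 0, v != 0 & (a / v) ^+ l = (b / u) ^+ k].
  have [ol|el] := boolP (odd l).
    have [v vr vl] := real_odd_root ol yr.
    have v0 : v != 0 by apply: contraNneq y0 => v0; rewrite -vl v0 expr0n gtn_eqF.
    exists 1, v; split; rewrite ?real1 ?oner_eq0 // divr1 expr_div_n vl.
    by rewrite /y invfM invrK mulrA divff ?mul1r // expf_neq0.
  have ok : odd k.
    apply/negPn/negP => ek.
    have : (2 %| gcdn k l)%N by rewrite dvdn_gcd !dvdn2 ek el.
    by rewrite (eqP ckl).
  have yVr : y^-1 \is Num.real by rewrite realV.
  have [u ur uk] := real_odd_root ok yVr.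
  have u0 : u != 0.
    apply: contraNneq y0 => u0; rewrite -invr_eq0 -uk u0 expr0n.
    by rewrite gtn_eqF // odd_gt0.
  exists u, 1; split; rewrite ?real1 ?oner_eq0 // divr1 expr_div_n uk invrK.
  by rewrite /y mulrCA divff ?mulr1.
have [c [c0 cl ck]] := coprime_common_base ckl l0
  (mulf_neq0 a0 (invr_neq0 v0)) (mulf_neq0 b0 (invr_neq0 u0)) E.
by exists u, v, c; split=> //; rewrite ?cl ?ck mulrC divfK.
Qed.

Lemma binomial_equimodular (R : realType) (k l : nat) (a : R[i]) :
  a != 0 -> (0 < l < k)%N -> has_two_equimodular_zeros (trinomial k l a 0).
Proof.
move=> a0 /andP[l0 lk]; have [s [hs sz E]] := trinomial_factor 0 a0 lk.
exists s => //; exists 0, 1; split; first by rewrite sz; lia.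
have root_norm i : (i < k)%N -> `|s`_i| ^+ k = `|a|^-1.
  move=> ik; have : root (trinomial k l a 0) s`_i.
    by rewrite E rootZ // root_prod_XsubC mem_nth ?sz.
  rewrite /root horner_trinomial mul0r addr0 addr_eq0 => /eqP asi.
  have : `|a| * `|s`_i| ^+ k = 1 by rewrite -normrX -normrM asi normrN1.
  by move=> h; rewrite -[LHS](mulKf (_ : `|a| != 0)) ?normr_eq0 // h mulr1.
rewrite /equimodular -(@eqrXn2 _ k) ?normr_ge0 //; last by lia.
by rewrite !root_norm //; lia.
Qed.

Lemma quadratic_equimodular (R : realType) (a b : R[i]) (q : nat -> R[i]) (n : nat) :
    a != 0 -> trinomial_rec 2 1 (- b) (- a) q -> q n = 0 ->
  has_two_equimodular_zeros (trinomial 2 1 a b).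
Proof.
move=> a0 [q0 qr] qn; have [s [hs sz E]] := trinomial_factor b a0 (isT : (1 < 2)%N).
case: s sz hs E => // s [|t [|//]] // _ hs E.
exists [:: s; t] => //; exists 0, 1; split=> //=.
have EQ : \prod_(z <- [:: s; t]) ('X - z%:P) = 'X^2 - (s + t) *: 'X + (s * t)%:P.
  by rewrite !big_cons big_nil -mul_polyC polyCD polyCM; ring.
have coefE' i : (trinomial 2 1 a b)`_i =
    a * ((i == 2)%:R - (s + t) * (i == 1)%:R + (if i == 0 then s * t else 0)).
  by rewrite E EQ coefZ !coefD coefN coefXn coefZ coefX coefC.
have E0 : a * (s * t) = 1.
  by have := coefE' 0; rewrite coef_trinomial /= !mulr0 !add0r oppr0 add0r => /esym.
have E1 : - b = a * (s + t).
  have := coefE' 1; rewrite coef_trinomial /= !mulr0 !mulr1 add0r !addr0 sub0r => ->.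
  by rewrite mulrN opprK.
have Ea : - a = - (a * s) * (a * t) by rewrite -[LHS]mulr1 -E0; ring.
have closed m : q m * (a * s - a * t) = (a * s) ^+ m.+1 - (a * t) ^+ m.+1 /\
    q m.+1 * (a * s - a * t) = (a * s) ^+ m.+2 - (a * t) ^+ m.+2.
  elim: m => [|m [IH1 IH2]].
    by rewrite (qr 1) //= q0 E1 mulr0 addr0; split; ring.
  split=> //; rewrite (qr m.+2) //= subn1 subn2 /= mulrDl -mulrA IH2 -mulrA IH1 E1 Ea.
  by rewrite ![_ ^+ m.+3]exprS ![_ ^+ m.+2]exprS ![_ ^+ m.+1]exprS; ring.
have [] := closed n; rewrite qn mul0r => /esym /eqP; rewrite subr_eq0 => /eqP E2 _.
have : `|a * s| ^+ n.+1 == `|a * t| ^+ n.+1 by rewrite -!normrX E2.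
by rewrite eqrXn2 ?normr_ge0 // !normrM (inj_eq (mulfI _)) ?normr_eq0.
Qed.

Lemma trinomial_collinear_zeros (R : realType) (k l : nat) (a b c : R[i])
    (s : seq R[i]) :
    (0 < l < k)%N -> a != 0 -> c != 0 -> size s = k ->
    trinomial k l a b = a *: \prod_(z <- s) ('X - z%:P) ->
    all (fun z => c * z \is Num.real) s ->
  [/\ 0 \notin s, (l <= 2)%N, (k - l <= 2)%N,
    l != 1 -> \sum_(z <- s) (c * z)^-1 = 0
    & (k - l)%N != 1 -> \sum_(z <- s) (c * z) = 0].
Proof.
move=> /andP[l0 lk] a0 c0 sz E sr.
have k1 : (1 == k) = false by lia.
have ne1 : (k - l)%N != 1 ->
    [/\ k.-1 != k, k.-1 != l & k.-1 != 0 /\ (k.+1 < 2)%N = false].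
  by move=> ?; split; [| |split]; lia.
have ne_low : (2 < l)%N -> [/\ l != 1, 2 != k & 2 != l] by move=> ?; split; lia.
have ne_high : (2 < k - l)%N ->
    [/\ (k - l)%N != 1, k.-2 != k, k.-2 != l, k.-2 != 0 & (k < 2)%N = false].
  by move=> ?; split; lia.
have E' i : (trinomial k l a b)`_i = a * (\prod_(z <- s) ('X - z%:P))`_i.
  by rewrite E coefZ.
have s0 : 0 \notin s.
  rewrite -root_prod_XsubC -(rootZ _ _ a0) -E /root horner_trinomial.
  by rewrite !expr0n !gtn_eqF ?mulr0 ?add0r ?oner_eq0 // (leq_trans _ lk).
have [p0 p1 p2] := coef_low_prod_XsubC s0.
have [t1 t2] := coef_high_prod_XsubC s.
have ss : s != [::] by rewrite -size_eq0 sz; lia.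
have cs0 : 0 \notin [seq c * z | z <- s].
  by rewrite -(mulr0 c) (mem_map (mulfI c0)).
have cs : [seq c * z | z <- s] != [::] by rewrite -size_eq0 size_map size_eq0.
have csr : all (fun z => z \is Num.real) [seq c * z | z <- s] by rewrite all_map.
have coefQ0 i : i != k -> i != l -> i != 0 -> (\prod_(z <- s) ('X - z%:P))`_i = 0.
  move=> ik il i0; have := E' i.
  rewrite coef_trinomial (negbTE ik) (negbTE il) (negbTE i0).
  by rewrite !mulr0 !addr0 => /esym/eqP; rewrite mulf_eq0 (negbTE a0) => /eqP.
have low1 : l != 1 -> \sum_(z <- s) z^-1 = 0.
  move=> l1; move: p1; rewrite coefQ0 // ?k1 //; last by rewrite eq_sym.
  move/esym/eqP; rewrite mulf_eq0 oppr_eq0 (negbTE p0) /=.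
  by move/eqP.
have high1 : (k - l)%N != 1 -> \sum_(z <- s) z = 0.
  move=> /ne1[n1 n2 [n3 n4]]; move: t1; rewrite coefXnM sz n4 subn2 coefQ0 //.
  by move/esym/eqP; rewrite oppr_eq0 => /eqP.
split=> //.
- rewrite leqNgt; apply/negP => /ne_low[l1 lk2 ll2].
  move: p2; rewrite coefQ0 // mul0rn low1 // expr0n /= sub0r mulrN => /esym/eqP.
  rewrite oppr_eq0 mulf_eq0 (negbTE p0) /= => /eqP sum2.
  have /negP[] : \sum_(z <- [seq z^-1 | z <- [seq c * z | z <- s]]) z ^+ 2 != 0.
    apply: real_sqr_sum_neq0.
    - by rewrite all_map; apply: sub_all csr => z /=; rewrite realV.
    - by rewrite -invr0 (mem_map invr_inj).
    - by rewrite -size_eq0 !size_map size_eq0.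
  rewrite !big_map; under eq_bigr do rewrite invfM exprMn.
  by rewrite -mulr_sumr sum2 mulr0.
- rewrite leqNgt; apply/negP => /ne_high[kl1 n1 n2 n3 n4].
  move: t2; rewrite coefXnM sz n4 subn2 coefQ0 // mul0rn high1 //.
  rewrite expr0n /= sub0r => /esym/eqP; rewrite oppr_eq0 => /eqP sum2.
  have /negP[] := real_sqr_sum_neq0 csr cs0 cs.
  rewrite !big_map; under eq_bigr do rewrite exprMn.
  by rewrite -mulr_sumr sum2 mulr0.
- by move=> l1; under eq_bigr do rewrite invfM; rewrite -mulr_sumr low1 // mulr0.
- by move=> kl1; rewrite -mulr_sumr high1 // mulr0.
Qed.

Lemma trinomial_real_dichotomy (R : realType) (k l : nat) (a b : R[i]) :
    coprime k l -> (0 < l < k)%N -> (2 < k)%N -> a != 0 -> b != 0 ->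
    (- a) ^+ l / (- b) ^+ k \is Num.real ->
  has_two_equimodular_zeros (trinomial k l a b) \/
  has_exactly_null_collinear_zeros (if odd k then 3 else 2)%N (trinomial k l a b).
Proof.
move=> ckl lk0 k2 a0 b0 yr; have /andP[l0 lk] := lk0.
have k3 : (l <= 2)%N -> (k - l <= 2)%N -> k = 3.
  move=> l2 kl2; have [//|[k4 l2E]] : k = 3 \/ k = 4 /\ l = 2 by lia.
  by rewrite k4 l2E in ckl.
have na0 : - a != 0 by rewrite oppr_eq0.
have nb0 : - b != 0 by rewrite oppr_eq0.
have [u [v [c [ur vr c0 bu av]]]] := real_rescale ckl l0 na0 nb0 yr.
have [s [hs sz E]] := trinomial_factor b a0 lk.
have rootE z : (z \in s) = (v * (c * z) ^+ k + u * (c * z) ^+ l == 1).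
  rewrite -root_prod_XsubC -(rootZ _ _ a0) -E /root horner_trinomial.
  rewrite -[a]opprK -[b]opprK bu av -[RHS]subr_eq0 -[RHS]oppr_eq0.
  by congr (_ == _); rewrite !exprMn; ring.
have [sr|] := boolP (all (fun z => c * z \is Num.real) s); last first.
  move=> /allPn[z zs znr]; left; pose w := (c * z)^*%C / c.
  have cw : c * w = (c * z)^*%C by rewrite /w mulrC divfK.
  apply: (equimodular_of_distinct (x := z) (y := w) hs zs).
  - have [[v' vE] [u' uE]] := (complex_realP _ vr, complex_realP _ ur).
    rewrite rootE cw -(conjc1 R); move: zs; rewrite rootE => /eqP <-.
    by rewrite rmorphD !rmorphM !rmorphXn /= rmorphM vE uE !conjc_real.
  - apply: contra znr => /eqP zw; rewrite zw cw.
    have : (c * z)^*%C = c * z by rewrite -cw -zw.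
    case: (c * z) => x y [] /eqP; rewrite -subr_eq0 -opprD oppr_eq0 -mulr2n mulrn_eq0 /=.
    by rewrite complex_real oppr_eq0.
  - apply: (mulfI (_ : `|c| != 0)); first by rewrite normr_eq0.
    by rewrite -!normrM cw normcJ.
right; have [s0 l2 kl2 low high] := trinomial_collinear_zeros lk0 a0 c0 sz E sr.
have {}k3 := k3 l2 kl2.
exists s => //; exists c^-1.
have online z : on_line c^-1 z = (c * z \is Num.real) by rewrite /on_line invrK mulrC.
have -> : [seq z <- s | on_line c^-1 z] = s.
  by apply/all_filterP; rewrite (eq_all online).
split; first by rewrite sz k3.
have cs0 : 0 \notin [seq c * z | z <- s].
  by rewrite -(mulr0 c) (mem_map (mulfI c0)).
have cs : [seq c * z | z <- s] != [::] by rewrite -size_eq0 size_map sz k3.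
have csr : all (fun z => z \is Num.real) [seq c * z | z <- s] by rewrite all_map.
have [pos neg] : has (fun z => 0 < z) [seq c * z | z <- s] /\
    has (fun z => z < 0) [seq c * z | z <- s].
  have [l1|l1] := eqVneq l 1.
    have sum0 : \sum_(z <- [seq c * z | z <- s]) z = 0 by rewrite big_map high // k3 l1.
    by split; [exact: real_sum0_has_gt0 sum0|exact: real_sum0_has_lt0 sum0].
  pose i := [seq z^-1 | z <- [seq c * z | z <- s]].
  have i0 : 0 \notin i by rewrite -invr0 (mem_map invr_inj).
  have ni : i != [::] by rewrite -size_eq0 !size_map sz k3.
  have ir : all (fun z => z \is Num.real) i.
    by rewrite all_map; apply: sub_all csr => z /=; rewrite realV.
  have sum0 : \sum_(z <- i) z = 0 by rewrite !big_map low.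
  have := real_sum0_has_gt0 ir i0 ni sum0; have := real_sum0_has_lt0 ir i0 ni sum0.
  rewrite ![has _ i]has_map => n p; split.
    by apply: sub_has p => z /=; rewrite invr_gt0.
  by apply: sub_has n => z /=; rewrite invr_lt0.
rewrite /null_collinear_along invr_neq0 //= (eq_all online) sr /=.
move: pos neg; rewrite !has_map => pos neg; apply/andP; split.
  by apply: sub_has pos => z /=; rewrite invrK mulrC.
by apply: sub_has neg => z /=; rewrite invrK mulrC.
Qed.

Lemma three_term_sequence_rec (R : realType) (k l : nat) (A B : {poly R[i]})
    (P : int -> {poly R[i]}) :
    (0 < l < k)%N -> three_term_sequence k l A B P ->
  trinomial_rec k l (- B) (- A) (fun n : nat => P n).
Proof.
move=> /andP[l0 lk] [hr h0 hz]; split=> // n n0.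
have H d : (0 < d <= k)%N -> P (n%:Z - d%:Z) = if (d <= n)%N then P (n - d)%N else 0.
  move=> dk; case: ifP => dn; first by rewrite subzn.
  by apply: hz; lia.
have := hr n; rewrite !H; try lia.
move=> /(_ ltac:(lia)) /eqP; rewrite -addrA addr_eq0 => /eqP ->.
by rewrite opprD !mulNr.
Qed.

Lemma trinomial_rec_horner (K : comNzRingType) (k l : nat) (b a : {poly K})
    (q : nat -> {poly K}) (x : K) :
  trinomial_rec k l b a q -> trinomial_rec k l b.[x] a.[x] (fun n => (q n).[x]).
Proof.
move=> [q0 qr]; split=> [|n n0]; first by rewrite q0 hornerC.
by rewrite qr // hornerD !hornerM; do 2![case: ifP => _]; rewrite ?horner0.
Qed.

Theorem corollary1p6 (R : realType) (k l : nat) (A B : {poly R[i]})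
    (P : int -> {poly R[i]}) (z0 : R[i])
    (hkl : coprime k l) (hlk : (l < k)%N) (hl : (1 <= l)%N)
    (hA : A != 0) (hB : B != 0) (hAB : (1 <= (size (A * B)%R).-1)%N)
    (hP : three_term_sequence k l A B P)
    (hz0 : (zeros_of_set (nonzero_terms P) `\` zeros A) z0) :
  has_two_equimodular_zeros (Dpoly k l A B z0) \/
  has_exactly_null_collinear_zeros (if odd k then 3 else 2)%N
    (Dpoly k l A B z0).
Proof.
have lk : (0 < l < k)%N by rewrite hl.
have k0 : (0 < k)%N by lia.
case: hz0 => -[f [f0 [[n|n] // _ fP]] fz] /negP a0.
rewrite /Dpoly -/(trinomial k l A.[z0] B.[z0]).
have recP := three_term_sequence_rec lk hP.
have repn : representable k l n.
  apply: contrapT => nrep; move: f0; rewrite fP.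
  by rewrite (trinomial_rec_nonrep hl k0 recP nrep) eqxx.
have := trinomial_rec_horner z0 recP; rewrite !hornerN => recq.
have qn : (P n).[z0] = 0 by move: fz; rewrite fP => /rootP.
have [b0|b0] := eqVneq B.[z0] 0; first by left; rewrite b0; exact: binomial_equimodular.
have [k2|k2] := leqP k 2.
  have [k2E l1E] : k = 2 /\ l = 1 by lia.
  by left; subst k l; exact: quadratic_equimodular recq qn.
apply: trinomial_real_dichotomy => //; apply: ltr0_real.
by apply: trinomial_rec_zero_lt0 recq repn qn; rewrite // oppr_eq0.
Qed.
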